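(* Let $M$ be a right $R$-module and $S=\mathrm{End}_R(M)$. (1) Assume that $M$ is a flat left $S$-module. (i) If $M$ is a self-CS-Rickart right $R$-module, then $S$ is a self-CS-Rickart right $S$-module. (ii) If $M$ is a faithfully projective right $R$-module and $S$ is a self-CS-Rickart right $S$-module, then $M$ is a self-CS-Rickart right $R$-module. (2) Assume that $M$ is a projective right $R$-module. (i) If $S$ is a dual self-CS-Rickart right $S$-module, then $M$ is a dual self-CS-Rickart right $R$-module. (ii) If $M$ is a faithfully flat left $S$-module and $M$ is a dual self-CS-Rickart right $R$-module, then $S$ is a dual self-CS-Rickart right $S$-module. (3) Assume that $M$ is an injective left $S$-module. (i) If $M$ is a dual self-CS-Rickart right $R$-module, then $S$ is a self-CS-Rickart left $S$-module. (ii) If $M$ is a faithfully injective right $R$-module and $S$ is a self-CS-Rickart left $S$-module, then $M$ is a dual self-CS-Rickart right $R$-module.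
   Context: In an abelian category: a morphism $s:A\to B$ is a section (resp. $r:A\to B$ is a retraction) if there is $s':B\to A$ with $s's=1_A$ (resp. $r':B\to A$ with $rr'=1_B$). A monomorphism $f:X\to Y$ is essential if for every morphism $h:Y\to P$ such that $hf$ is a monomorphism, $h$ is a monomorphism. An epimorphism $f:X\to Y$ is superfluous if for every morphism $h:P\to X$ such that $fh$ is an epimorphism, $h$ is an epimorphism. An object $N$ of an abelian category is self-CS-Rickart if for every endomorphism $f:N\to N$ there are an essential monomorphism $e:\mathrm{Ker}(f)\to L$ and a section $s:L\to N$ with $\ker(f)=se$; it is dual self-CS-Rickart if for every endomorphism $f:N\to N$ there are a retraction $r:N\to P$ and a superfluous epimorphism $t:P\to \mathrm{Coker}(f)$ with $\mathrm{coker}(f)=tr$. For modules these notions are taken in the corresponding module category. $R$ is a ring with identity; $\mathrm{Mod}(R)$ denotes right $R$-modules, and $\mathrm{Mod}(S^{\mathrm{op}})$ denotes left $S$-modules. $M$ is an $(S,R)$-bimodule via evaluation of endomorphisms. A covariant functor $F$ between abelian categories is faithfully exact if $F(A)\to F(B)\to F(C)$ (with maps $F(f),F(g)$) is exact if and only if $A\xrightarrow{f} B\xrightarrow{g} C$ is exact; for contravariant $F$ the condition is that $F(C)\to F(B)\to F(A)$ is exact if and only if $A\xrightarrow{f} B\xrightarrow{g} C$ is exact. The right $R$-module $M$ is faithfully projective if $\mathrm{Hom}_R(M,-):\mathrm{Mod}(R)\to \mathrm{Mod}(S)$ is faithfully exact; it is faithfully injective if $\mathrm{Hom}_R(-,M):\mathrm{Mod}(R)\to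 \mathrm{Mod}(S^{\mathrm{op}})$ is faithfully exact; the left $S$-module $M$ is faithfully flat if $-\otimes_S M:\mathrm{Mod}(S)\to \mathrm{Mod}(R)$ is faithfully exact. *)

(* Defs.v *)
(* The classical axioms of boolp give the Hom sets decidable equality and
   choice, and turn subgroups into boolean predicates. *)
From HB Require Import structures.
From mathcomp Require Import all_boot all_algebra.
From mathcomp Require Import boolp.
From mathcomp Require Import freeg.

Set Implicit Arguments.
Unset Strict Implicit.
Unset Printing Implicit Defensive.

Import GRing.Theory.
Local Open Scope ring_scope.

(* A left R-module is an [lmodType R] and a right R-module is an
   [lmodType R^c]; if X : lmodType R^c, then [a *: x] stands for x a.  In the
   regular right module [R^c^o], [a *: x] unfolds to the product x * a in R.
   Morphisms are compared pointwise. *)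

Section ModuleCategory.
Context {R : pzRingType}.
Implicit Types X Y Z N K L P C : lmodType R.

Definition monomorphism X Y (f : {linear X -> Y}) : Prop :=
  forall Z (g h : {linear Z -> X}), f \o g =1 f \o h -> g =1 h.

Definition epimorphism X Y (f : {linear X -> Y}) : Prop :=
  forall Z (g h : {linear Y -> Z}), g \o f =1 h \o f -> g =1 h.

Definition is_section X Y (s : {linear X -> Y}) : Prop :=
  exists s' : {linear Y -> X}, s' \o s =1 id.

Definition is_retraction X Y (r : {linear X -> Y}) : Prop :=
  exists r' : {linear Y -> X}, r \o r' =1 id.

Definition essential_mono X Y (f : {linear X -> Y}) : Prop :=
  monomorphism f /\
  forall P (h : {linear Y -> P}), monomorphism (h \o f) -> monomorphism h.

Definition superfluous_epi X Y (f : {linear X -> Y}) : Prop :=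
  epimorphism f /\
  forall P (h : {linear P -> X}), epimorphism (f \o h) -> epimorphism h.

Definition is_kernel X Y K (f : {linear X -> Y}) (k : {linear K -> X}) : Prop :=
  f \o k =1 \0 /\
  forall Z (h : {linear Z -> X}), f \o h =1 \0 ->
    exists2 h' : {linear Z -> K}, k \o h' =1 h &
      forall h'' : {linear Z -> K}, k \o h'' =1 h -> h'' =1 h'.

Definition is_cokernel X Y C (f : {linear X -> Y}) (c : {linear Y -> C}) :
    Prop :=
  c \o f =1 \0 /\
  forall Z (h : {linear Y -> Z}), h \o f =1 \0 ->
    exists2 h' : {linear C -> Z}, h' \o c =1 h &
      forall h'' : {linear C -> Z}, h'' \o c =1 h -> h'' =1 h'.

(* Kernels and cokernels exist and are unique up to isomorphism, and the
   conditions below do not depend on which one is chosen. *)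
Definition self_CS_Rickart N : Prop :=
  forall f : {linear N -> N},
  exists K (k : {linear K -> N}), is_kernel f k /\
  exists L (e : {linear K -> L}) (s : {linear L -> N}),
    [/\ essential_mono e, is_section s & k =1 s \o e].

Definition dual_self_CS_Rickart N : Prop :=
  forall f : {linear N -> N},
  exists C (c : {linear N -> C}), is_cokernel f c /\
  exists P (r : {linear N -> P}) (t : {linear P -> C}),
    [/\ is_retraction r, superfluous_epi t & c =1 t \o r].

Definition projective P : Prop :=
  forall X Y (g : {linear X -> Y}) (h : {linear P -> Y}), epimorphism g ->
    exists h' : {linear P -> X}, g \o h' =1 h.

Definition injective_module N : Prop :=
  forall X Y (g : {linear X -> Y}) (h : {linear X -> N}), monomorphism g ->
    exists h' : {linear Y -> N}, h' \o g =1 h.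

End ModuleCategory.

Definition exact (A B C : zmodType) (f : A -> B) (g : B -> C) : Prop :=
  forall b, g b = 0 <-> exists a, f a = b.

Definition faithfully_exact (R S : pzRingType) (F : lmodType R -> lmodType S)
    (F1 : forall A B : lmodType R, {linear A -> B} -> {linear F A -> F B}) : Prop :=
  forall (A B C : lmodType R) (f : {linear A -> B}) (g : {linear B -> C}),
    exact (F1 A B f) (F1 B C g) <-> exact f g.

Definition faithfully_exact_contra (R S : pzRingType)
    (F : lmodType R -> lmodType S)
    (F1 : forall A B : lmodType R, {linear A -> B} -> {linear F B -> F A}) : Prop :=
  forall (A B C : lmodType R) (f : {linear A -> B}) (g : {linear B -> C}),
    exact (F1 B C g) (F1 A B f) <-> exact f g.

Definition hom (R : pzRingType) (A B : lmodType R) : Type := {linear A -> B}.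

Lemma linear_ext (R : pzRingType) (A B : lmodType R) (f g : {linear A -> B}) :
  f =1 g -> f = g.
Proof.
case: f g => [f [[f1] [f2]]] [g [[g1] [g2]]] /= /funext efg.
case: g / efg in g1 g2 *.
by rewrite (Prop_irrelevance f1 g1) (Prop_irrelevance f2 g2).
Qed.

Section HomZmodule.
Variables (R : pzRingType) (A B : lmodType R).

HB.instance Definition _ := gen_eqMixin (hom A B).
HB.instance Definition _ := gen_choiceMixin (hom A B).

Definition hom_zero : hom A B := \0 : {linear A -> B}.
Definition hom_opp (f : hom A B) : hom A B := \- f : {linear A -> B}.
Definition hom_add (f g : hom A B) : hom A B := f \+ g : {linear A -> B}.

Fact hom_addA : associative hom_add.
Proof. by move=> f g h; apply: linear_ext => x /=; rewrite addrA. Qed.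
Fact hom_addC : commutative hom_add.
Proof. by move=> f g; apply: linear_ext => x /=; rewrite addrC. Qed.
Fact hom_add0 : left_id hom_zero hom_add.
Proof. by move=> f; apply: linear_ext => x /=; rewrite add0r. Qed.
Fact hom_addN : left_inverse hom_zero hom_opp hom_add.
Proof. by move=> f; apply: linear_ext => x /=; rewrite addNr. Qed.

HB.instance Definition _ :=
  GRing.isZmodule.Build (hom A B) hom_addA hom_addC hom_add0 hom_addN.

End HomZmodule.

Definition hom_comp (R : pzRingType) (A B C : lmodType R)
  (f : hom B C) (g : hom A B) : hom A C := f \o g : {linear A -> C}.

Definition endo (R : pzRingType) (M : lmodType R) : Type := hom M M.

Section EndoRing.
Variables (R : pzRingType) (M : lmodType R).

HB.instance Definition _ := GRing.Zmodule.copy (endo M) (hom M M).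

Definition endo_one : endo M := (idfun : {linear M -> M}).
Definition endo_mul (f g : endo M) : endo M := hom_comp f g.

Fact endo_mulA : associative endo_mul.
Proof. by move=> f g h; apply: linear_ext. Qed.
Fact endo_mul1 : left_id endo_one endo_mul.
Proof. by move=> f; apply: linear_ext. Qed.
Fact endo_mulr1 : right_id endo_one endo_mul.
Proof. by move=> f; apply: linear_ext. Qed.
Fact endo_mulDl : left_distributive endo_mul +%R.
Proof. by move=> f g h; apply: linear_ext. Qed.
Fact endo_mulDr : right_distributive endo_mul +%R.
Proof. by move=> f g h; apply: linear_ext => x /=; rewrite raddfD. Qed.

HB.instance Definition _ := GRing.Zmodule_isPzRing.Build (endo M)
  endo_mulA endo_mul1 endo_mulr1 endo_mulDl endo_mulDr.

End EndoRing.

(* M as a left End(M)-module: s *: m = s m. *)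
Definition evalmod (R : pzRingType) (M : lmodType R) : Type := M.

Section EvalModule.
Variables (R : pzRingType) (M : lmodType R).

HB.instance Definition _ := GRing.Zmodule.copy (evalmod M) M.

Definition eval_scale (s : endo M) (m : evalmod M) : evalmod M := s m.

Fact eval_scaleA a b m : eval_scale a (eval_scale b m) = eval_scale (a * b) m.
Proof. by []. Qed.
Fact eval_scale1 : left_id 1 eval_scale.
Proof. by []. Qed.
Fact eval_scaleDr : right_distributive eval_scale +%R.
Proof. by move=> s m n; apply: raddfD. Qed.
Fact eval_scaleDl m : {morph eval_scale^~ m : a b / a + b}.
Proof. by []. Qed.

HB.instance Definition _ :=
  GRing.Zmodule_isLmodule.Build (endo M) (evalmod M)
    eval_scaleA eval_scale1 eval_scaleDr eval_scaleDl.

End EvalModule.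

(* Hom(M, A) as a right End(M)-module: u s = u \o s. *)
Definition hom_from (R : pzRingType) (M A : lmodType R) : Type := hom M A.

Section HomFrom.
Variables (R : pzRingType) (M : lmodType R).

Section Object.
Variable A : lmodType R.

HB.instance Definition _ := GRing.Zmodule.copy (hom_from M A) (hom M A).

Definition hom_from_scale (s : (endo M)^c) (u : hom_from M A) : hom_from M A :=
  hom_comp u s.

Fact hom_from_scaleA a b u :
  hom_from_scale a (hom_from_scale b u) = hom_from_scale (a * b) u.
Proof. exact: linear_ext. Qed.
Fact hom_from_scale1 : left_id 1 hom_from_scale.
Proof. by move=> u; apply: linear_ext. Qed.
Fact hom_from_scaleDr : right_distributive hom_from_scale +%R.
Proof. by move=> s u v; apply: linear_ext. Qed.
Fact hom_from_scaleDl u : {morph hom_from_scale^~ u : a b / a + b}.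
Proof. by move=> a b; apply: linear_ext => x /=; rewrite raddfD. Qed.

HB.instance Definition _ :=
  GRing.Zmodule_isLmodule.Build (endo M)^c (hom_from M A)
    hom_from_scaleA hom_from_scale1 hom_from_scaleDr hom_from_scaleDl.
End Object.

Variables (A B : lmodType R) (f : {linear A -> B}).

Definition hom_from_map (u : hom_from M A) : hom_from M B := hom_comp f u.

Fact hom_from_map_is_linear : linear hom_from_map.
Proof. by move=> s u v; apply: linear_ext => x /=; rewrite raddfD. Qed.

HB.instance Definition _ := GRing.isLinear.Build (endo M)^c
  (hom_from M A) (hom_from M B) _ hom_from_map hom_from_map_is_linear.

End HomFrom.

(* Hom(A, M) as a left End(M)-module: s u = s \o u. *)
Definition hom_to (R : pzRingType) (M A : lmodType R) : Type := hom A M.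

Section HomTo.
Variables (R : pzRingType) (M : lmodType R).

Section Object.
Variable A : lmodType R.

HB.instance Definition _ := GRing.Zmodule.copy (hom_to M A) (hom A M).

Definition hom_to_scale (s : endo M) (u : hom_to M A) : hom_to M A :=
  hom_comp s u.

Fact hom_to_scaleA a b u :
  hom_to_scale a (hom_to_scale b u) = hom_to_scale (a * b) u.
Proof. exact: linear_ext. Qed.
Fact hom_to_scale1 : left_id 1 hom_to_scale.
Proof. by move=> u; apply: linear_ext. Qed.
Fact hom_to_scaleDr : right_distributive hom_to_scale +%R.
Proof. by move=> s u v; apply: linear_ext => x /=; rewrite raddfD. Qed.
Fact hom_to_scaleDl u : {morph hom_to_scale^~ u : a b / a + b}.
Proof. by move=> a b; apply: linear_ext. Qed.

HB.instance Definition _ :=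
  GRing.Zmodule_isLmodule.Build (endo M) (hom_to M A)
    hom_to_scaleA hom_to_scale1 hom_to_scaleDr hom_to_scaleDl.
End Object.

Variables (A B : lmodType R) (f : {linear A -> B}).

Definition hom_to_map (u : hom_to M B) : hom_to M A := hom_comp u f.

Fact hom_to_map_is_linear : linear hom_to_map.
Proof. by move=> s u v; apply: linear_ext. Qed.

HB.instance Definition _ := GRing.isLinear.Build (endo M)
  (hom_to M B) (hom_to M A) _ hom_to_map hom_to_map_is_linear.

End HomTo.

Definition faithfully_projective (R : pzRingType) (M : lmodType R) : Prop :=
  @faithfully_exact R (endo M)^c (fun A => hom_from M A)
    (fun A B f => @hom_from_map R M A B f).

Definition faithfully_injective (R : pzRingType) (M : lmodType R) : Prop :=
  @faithfully_exact_contra R (endo M) (fun A => hom_to M A)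
    (fun A B f => @hom_to_map R M A B f).

(* The tensor product of a right module X and a left module N: the free abelian
   group on X * N modulo the subgroup generated by the balancing relations. *)
Section Tensor.
Variables (S : pzRingType) (X : lmodType S^c) (N : lmodType S).

Inductive tensor_rel : {freeg (X * N)%type} -> Prop :=
| tensor_rel0 : tensor_rel 0
| tensor_relB u v : tensor_rel u -> tensor_rel v -> tensor_rel (u - v)
| tensor_rel_Dl x y n :
    tensor_rel (<< (x + y, n) >> - << (x, n) >> - << (y, n) >>)
| tensor_rel_Dr x n m :
    tensor_rel (<< (x, n + m) >> - << (x, n) >> - << (x, m) >>)
| tensor_rel_Z (s : S) x n :
    tensor_rel (<< ((s : S^c) *: x, n) >> - << (x, s *: n) >>).

Definition tensor_relb : {pred {freeg (X * N)%type}} :=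
  fun u => `[< tensor_rel u >].

Fact tensor_relb_closed : zmod_closed tensor_relb.
Proof.
split; first exact/asboolP/tensor_rel0.
by move=> u v /asboolP hu /asboolP hv; apply/asboolP/tensor_relB.
Qed.

HB.instance Definition _ :=
  GRing.isZmodClosed.Build {freeg (X * N)%type} tensor_relb tensor_relb_closed.

Definition tensor : Type :=
  @Quotient.quot {freeg (X * N)%type} tensor_relb.

HB.instance Definition _ := GRing.Zmodule.on tensor.

Definition tens (x : X) (n : N) : tensor := \pi_tensor%qT << (x, n) >>.

Lemma tensDl x y n : tens (x + y) n = tens x n + tens y n.
Proof.
rewrite /tens -raddfD /=; apply/eqP; rewrite -Quotient.idealrBE opprD addrA.
exact/asboolP/tensor_rel_Dl.
Qed.

Lemma tensDr x n m : tens x (n + m) = tens x n + tens x m.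
Proof.
rewrite /tens -raddfD /=; apply/eqP; rewrite -Quotient.idealrBE opprD addrA.
exact/asboolP/tensor_rel_Dr.
Qed.

Lemma tensZ (s : S) x n : tens ((s : S^c) *: x) n = tens x (s *: n).
Proof.
rewrite /tens; apply/eqP; rewrite -Quotient.idealrBE.
exact/asboolP/tensor_rel_Z.
Qed.

Definition balanced (V : zmodType) (b : X -> N -> V) : Prop :=
  [/\ forall x y n, b (x + y) n = b x n + b y n,
      forall x n m, b x (n + m) = b x n + b x m
    & forall (s : S) x n, b ((s : S^c) *: x) n = b x (s *: n)].

(* The additive extension of b (a [zmodule V] is V as a Z-module). *)
Definition tensor_lift (V : zmodType) (b : X -> N -> V) (t : tensor) : V :=
  fglift (fun p => b p.1 p.2 : ssrint.zmodule V) (repr t).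

Section Lift.
Variables (V : zmodType) (b : X -> N -> V).
Hypothesis b_balanced : balanced b.

Let lift0 (u : {freeg (X * N)%type}) : V :=
  fglift (fun p => b p.1 p.2 : ssrint.zmodule V) u.

Let lift0B u v : lift0 (u - v) = lift0 u - lift0 v.
Proof. exact: (lift_is_additive (fun p => b p.1 p.2 : ssrint.zmodule V)). Qed.

Let lift0U x n : lift0 << (x, n) >> = b x n.
Proof. by rewrite /lift0 liftU scale1r. Qed.

Let lift0_rel u : tensor_rel u -> lift0 u = 0.
Proof.
case: b_balanced => bDl bDr bZ.
elim=> [|{}u v _ IHu _ IHv|x y n|x n m|s x n].
- by rewrite -[X in lift0 X](subrr 0) lift0B subrr.
- by rewrite lift0B IHu IHv subrr.
- by rewrite !lift0B !lift0U bDl addrAC addrK subrr.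
- by rewrite !lift0B !lift0U bDr addrAC addrK subrr.
- by rewrite lift0B !lift0U bZ subrr.
Qed.

Let lift0_pi u : tensor_lift b (\pi_tensor%qT u) = lift0 u.
Proof.
apply/eqP; rewrite -subr_eq0 -[tensor_lift _ _]/(lift0 _) -lift0B.
apply/eqP/lift0_rel/asboolP; rewrite -[`[< _ >]]/(_ \in tensor_relb).
by rewrite Quotient.idealrBE reprK.
Qed.

Lemma tensor_liftE x n : tensor_lift b (tens x n) = b x n.
Proof. by rewrite /tens lift0_pi lift0U. Qed.

Lemma tensor_lift_is_zmod_morphism : zmod_morphism (tensor_lift b).
Proof.
move=> t u; rewrite -[t]reprK -[u]reprK -raddfB /= !lift0_pi.
exact: lift0B.
Qed.

End Lift.

Lemma tensor_ind (Q : tensor -> Prop) :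
  Q 0 -> (forall t u, Q t -> Q u -> Q (t - u)) ->
  (forall x n, Q (tens x n)) -> forall t, Q t.
Proof.
move=> Q0 QB Qtens t.
have QN u : Q u -> Q (- u) by rewrite -[- u]add0r; apply: QB.
have QD u v : Q u -> Q v -> Q (u + v).
  by move=> ? ?; rewrite -[v]opprK; apply/QB/QN.
rewrite -[t]reprK -[repr t]freeg_sumE raddf_sum /=.
elim/big_ind: _ => // -[x n] _.
rewrite -[coeff _ _]intz -freegU_mulz raddfMz.
have Qn k : Q (tens x n *+ k).
  by elim: k => [|k IHk]; rewrite ?mulr0n // mulrS; apply: QD.
by case: (coeff _ _) => k; rewrite ?NegzE ?mulrNz; [|apply: QN]; apply: Qn.
Qed.

Lemma tensor_ext (V : zmodType) (f g : {additive tensor -> V}) :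
  (forall x n, f (tens x n) = g (tens x n)) -> f =1 g.
Proof.
move=> fg; elim/tensor_ind=> [|t u IHt IHu|//]; first by rewrite !raddf0.
by rewrite !raddfB IHt IHu.
Qed.

End Tensor.

Section TensorMap.
Variables (S : pzRingType) (X Y : lmodType S^c) (N N' : lmodType S).
Variables (f : {linear X -> Y}) (g : {linear N -> N'}).

Definition tensor_map : tensor X N -> tensor Y N' :=
  tensor_lift (fun x n => tens (f x) (g n)).

Fact tensor_map_balanced : balanced (fun x n => tens (f x) (g n)).
Proof.
split=> [x y n|x n m|s x n]; first by rewrite raddfD tensDl.
  by rewrite raddfD tensDr.
by rewrite !linearZ tensZ.
Qed.

Lemma tensor_mapE x n : tensor_map (tens x n) = tens (f x) (g n).
Proof. exact: tensor_liftE tensor_map_balanced _ _. Qed.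

Fact tensor_map_is_zmod_morphism : zmod_morphism tensor_map.
Proof. exact: tensor_lift_is_zmod_morphism tensor_map_balanced. Qed.

HB.instance Definition _ := GRing.isZmodMorphism.Build
  (tensor X N) (tensor Y N') tensor_map tensor_map_is_zmod_morphism.

End TensorMap.

Definition flat (S : pzRingType) (N : lmodType S) : Prop :=
  forall (X Y Z : lmodType S^c) (f : {linear X -> Y}) (g : {linear Y -> Z}),
    exact f g ->
    exact (tensor_map f (idfun : {linear N -> N}))
          (tensor_map g (idfun : {linear N -> N})).

(* For a right R-module M, X \otimes_End(M) M as a right R-module:
   (x \otimes m) r = x \otimes (m r). *)
Definition tensor_eval (R : pzRingType) (M : lmodType R^c)
  (X : lmodType (endo M)^c) : Type := tensor X (evalmod M).

Section TensorEval.
Variables (R : pzRingType) (M : lmodType R^c).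

Definition eval_act (r : R^c) (m : evalmod M) : evalmod M := r *: (m : M).

Fact eval_act_is_linear r : linear (eval_act r).
Proof.
move=> s m n; rewrite /eval_act [LHS]scalerDr; congr (_ + _).
by rewrite -[s *: m]/(s m) -[RHS]/(s (r *: (m : M))) linearZ.
Qed.

HB.instance Definition _ r := GRing.isLinear.Build (endo M)
  (evalmod M) (evalmod M) _ (eval_act r) (eval_act_is_linear r).

Section Object.
Variable X : lmodType (endo M)^c.

HB.instance Definition _ :=
  GRing.Zmodule.copy (tensor_eval X) (tensor X (evalmod M)).

Definition tensor_eval_scale (r : R^c) (t : tensor_eval X) : tensor_eval X :=
  tensor_map (idfun : {linear X -> X}) (eval_act r) t.

Fact tensor_eval_scaleB r : {morph tensor_eval_scale r : t u / t - u}.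
Proof. exact: raddfB. Qed.

Fact tensor_eval_scale0 r : tensor_eval_scale r 0 = 0.
Proof. exact: raddf0. Qed.

Fact tensor_eval_scaleE r x m :
  tensor_eval_scale r (tens x m) = tens x (eval_act r m).
Proof. exact: tensor_mapE. Qed.

Fact tensor_eval_scaleA a b t :
  tensor_eval_scale a (tensor_eval_scale b t) = tensor_eval_scale (a * b) t.
Proof.
elim/tensor_ind: t => [|t u IHt IHu|x m]; first by rewrite !tensor_eval_scale0.
  by rewrite !tensor_eval_scaleB IHt IHu.
by rewrite !tensor_eval_scaleE /eval_act scalerA.
Qed.

Fact tensor_eval_scale1 : left_id 1 tensor_eval_scale.
Proof.
elim/tensor_ind=> [|t u IHt IHu|x m]; first by rewrite tensor_eval_scale0.
  by rewrite tensor_eval_scaleB IHt IHu.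
by rewrite tensor_eval_scaleE /eval_act scale1r.
Qed.

Fact tensor_eval_scaleDr : right_distributive tensor_eval_scale +%R.
Proof. by move=> r t u; apply: raddfD. Qed.

Fact tensor_eval_scaleDl t : {morph tensor_eval_scale^~ t : a b / a + b}.
Proof.
move=> a b; elim/tensor_ind: t => [|t u IHt IHu|x m].
- by rewrite !tensor_eval_scale0 addr0.
- by rewrite !tensor_eval_scaleB IHt IHu opprD addrACA.
by rewrite !tensor_eval_scaleE -[RHS]tensDr /eval_act scalerDl.
Qed.

HB.instance Definition _ := GRing.Zmodule_isLmodule.Build R^c (tensor_eval X)
  tensor_eval_scaleA tensor_eval_scale1
  tensor_eval_scaleDr tensor_eval_scaleDl.
End Object.

Variables (X Y : lmodType (endo M)^c) (f : {linear X -> Y}).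

Definition tensor_eval_map (t : tensor_eval X) : tensor_eval Y :=
  tensor_map f (idfun : {linear evalmod M -> evalmod M}) t.

Fact tensor_eval_map_is_linear : linear tensor_eval_map.
Proof.
have mapB : {morph tensor_eval_map : t u / t - u} by move=> ? ?; exact: raddfB.
have map0 : tensor_eval_map 0 = 0 by exact: raddf0.
have mapZ r t : tensor_eval_map (r *: t) = r *: tensor_eval_map t; last first.
  by move=> r t u; rewrite -mapZ; apply: raddfD.
elim/tensor_ind: t => [|t v IHt IHv|x m]; first by rewrite scaler0 map0 scaler0.
  by rewrite scalerBr !mapB IHt IHv scalerBr.
rewrite -[LHS]/(tensor_eval_map (tensor_eval_scale r (tens x m))).
rewrite -[RHS]/(tensor_eval_scale r (tensor_eval_map _)).
by rewrite tensor_eval_scaleE /tensor_eval_map !tensor_mapE tensor_eval_scaleE.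
Qed.

HB.instance Definition _ := GRing.isLinear.Build R^c
  (tensor_eval X) (tensor_eval Y) _ tensor_eval_map tensor_eval_map_is_linear.

End TensorEval.

(* M, as a left End(M)-module, is faithfully flat. *)
Definition faithfully_flat_eval (R : pzRingType) (M : lmodType R^c) : Prop :=
  @faithfully_exact (endo M)^c R^c (fun X => tensor_eval X)
    (fun X Y f => @tensor_eval_map R M X Y f).

(* Main.v *)
(* Up to isomorphism a direct summand of N is the image of an idempotent
   endomorphism g, so N is self-CS-Rickart iff every ker f is contained in, and
   essential in, some g N; dually, N is dual self-CS-Rickart iff for every f
   some g satisfies (1 - g) N <= f N with g N inter f N superfluous in g N.
   Endomorphisms of the regular S-module are multiplications by elements of S,
   that is, by endomorphisms of M, so M and S can share the same f and g and it
   remains to carry essentiality and superfluity across.  Flatness,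
   projectivity and injectivity carry them from one side to the other
   directly; the faithful functors do so because they detect nonzero maps. *)
Require Import Defs.
From HB Require Import structures.
From mathcomp Require Import all_boot all_algebra.
From mathcomp Require Import boolp.
Import GRing.Theory.
Local Open Scope ring_scope.
Set Implicit Arguments.
Unset Strict Implicit.
Unset Printing Implicit Defensive.

(** * Kernels as submodules, and monomorphisms *)

Section Kernel.
Variables (R : pzRingType) (X Y : lmodType R) (f : {linear X -> Y}).

Definition ker_pred : {pred X} := fun x => f x == 0.

Fact ker_submod_closed : submod_closed ker_pred.
Proof.
split=> [|a x y]; rewrite !unfold_in ?raddf0 // => /eqP fx /eqP fy.
by rewrite linearP fx fy scaler0 addr0.
Qed.

HB.instance Definition _ :=
  GRing.isSubmodClosed.Build R X ker_pred ker_submod_closed.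

Record ker := Ker { ker_val : X; ker_valP : ker_val \in ker_pred }.

HB.instance Definition _ := [isSub for ker_val].
HB.instance Definition _ := [Choice of ker by <:].
HB.instance Definition _ := [SubChoice_isSubLmodule of ker by <:].

Definition ker_incl : {linear ker -> X} := val.

Lemma ker_inclE k : f (ker_incl k) = 0.
Proof. exact/eqP/(valP k). Qed.

Lemma ker_incl_inj : injective ker_incl.
Proof. exact: val_inj. Qed.

Lemma ker_incl_surj x : f x = 0 -> exists k, ker_incl k = x.
Proof. by move/eqP=> fx; exists (Ker fx). Qed.

Section Lift.
Variables (Z : lmodType R) (h : {linear Z -> X}).
Hypothesis fh0 : forall z, f (h z) = 0.

Definition ker_lift (z : Z) : ker := Ker (introT eqP (fh0 z)).

Fact ker_lift_is_linear : linear ker_lift.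
Proof. by move=> a x y; apply: val_inj; rewrite /= linearP. Qed.

HB.instance Definition _ :=
  GRing.isLinear.Build R Z ker _ ker_lift ker_lift_is_linear.

End Lift.

Lemma ker_is_kernel : is_kernel f ker_incl.
Proof.
split=> [k|Z h fh0]; first exact: ker_inclE.
exists (ker_lift fh0) => // h' vh' z.
by apply: ker_incl_inj; apply: vh'.
Qed.

(** The inclusion of the kernel and the zero map agree after [f], so a monomorphism identifies
    them. *)
Lemma monomorphismP : monomorphism f <-> (forall x, f x = 0 -> x = 0).
Proof.
split=> [mono_f x /ker_incl_surj[k <-]|inj_f Z g h fgh z].
  apply: (mono_f _ ker_incl (\0 : {linear _ -> _})) => {}k.
  by rewrite /= raddf0; apply: ker_inclE.
apply/eqP; rewrite -subr_eq0; apply/eqP/inj_f.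
by rewrite raddfB; apply/eqP; rewrite subr_eq0; apply/eqP/fgh.
Qed.

End Kernel.

(** * Cokernels as quotient modules, and epimorphisms *)

Section Cokernel.
Variables (R : pzRingType) (X Y : lmodType R) (f : {linear X -> Y}).

Definition im_pred : {pred Y} := fun y => `[< exists x, f x = y >].

Fact im_submod_closed : submod_closed im_pred.
Proof.
split=> [|a x y]; rewrite ?unfold_in.
  by apply/asboolP; exists 0; apply: raddf0.
move=> /asboolP[u <-] /asboolP[v <-]; apply/asboolP.
by exists (a *: u + v); apply: linearP.
Qed.

HB.instance Definition _ :=
  GRing.isSubmodClosed.Build R Y im_pred im_submod_closed.

Definition coker : Type := @Quotient.quot Y im_pred.

HB.instance Definition _ := GRing.Zmodule.on coker.

Definition coker_pi (y : Y) : coker := \pi_coker%qT y.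

Lemma coker_pi_eq x y : coker_pi x = coker_pi y <-> exists u, f u = x - y.
Proof.
split=> [/eqP|im]; last apply/eqP; rewrite -Quotient.idealrBE.
  by move/asboolP.
exact/asboolP.
Qed.

Lemma coker_pi_surj z : exists y, coker_pi y = z.
Proof. by exists (repr z); rewrite /coker_pi reprK. Qed.

(** The quotient is one of abelian groups, so scaling goes through a representative. The choice is
    immaterial because the image of [f] is a submodule. *)
Definition coker_scale (a : R) (z : coker) : coker := coker_pi (a *: repr z).

Fact coker_scaleE a y : coker_scale a (coker_pi y) = coker_pi (a *: y).
Proof.
have /coker_pi_eq[u fu] : coker_pi (repr (coker_pi y)) = coker_pi y.
  by rewrite /coker_pi reprK.
by apply/coker_pi_eq; exists (a *: u); rewrite linearZ /= fu scalerBr.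
Qed.

Fact coker_piD x y : coker_pi (x + y) = coker_pi x + coker_pi y.
Proof. exact: raddfD. Qed.

Fact coker_scaleA a b z :
  coker_scale a (coker_scale b z) = coker_scale (a * b) z.
Proof. by case: (coker_pi_surj z) => y <-; rewrite !coker_scaleE scalerA. Qed.
Fact coker_scale1 : left_id 1 coker_scale.
Proof.
by move=> z; case: (coker_pi_surj z) => y <-; rewrite !coker_scaleE scale1r.
Qed.
Fact coker_scaleDr : right_distributive coker_scale +%R.
Proof.
move=> a z z'; case: (coker_pi_surj z) (coker_pi_surj z') => y <- [y' <-].
by rewrite !coker_scaleE -!coker_piD coker_scaleE scalerDr.
Qed.
Fact coker_scaleDl z : {morph coker_scale^~ z : a b / a + b}.
Proof.
move=> a b; case: (coker_pi_surj z) => y <-.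
by rewrite !coker_scaleE -coker_piD scalerDl.
Qed.

HB.instance Definition _ := GRing.Zmodule_isLmodule.Build R coker
  coker_scaleA coker_scale1 coker_scaleDr coker_scaleDl.

Fact coker_pi_is_linear : linear coker_pi.
Proof. by move=> a x y; rewrite coker_piD -coker_scaleE. Qed.

HB.instance Definition _ :=
  GRing.isLinear.Build R Y coker _ coker_pi coker_pi_is_linear.

Lemma coker_pi_eq0 y : coker_pi y = 0 <-> exists x, f x = y.
Proof.
have -> : 0 = coker_pi 0 by rewrite raddf0.
by split=> [/coker_pi_eq|[x fx]]; [|apply/coker_pi_eq; exists x]; rewrite subr0.
Qed.

Section Lift.
Variables (Z : lmodType R) (h : {linear Y -> Z}).

Definition coker_lift (_ : forall x, h (f x) = 0) (z : coker) : Z := h (repr z).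

Hypothesis hf0 : forall x, h (f x) = 0.

Lemma coker_liftE y : coker_lift hf0 (coker_pi y) = h y.
Proof.
have /coker_pi_eq[u fu] : coker_pi (repr (coker_pi y)) = coker_pi y.
  by rewrite /coker_pi reprK.
by apply/eqP; rewrite -subr_eq0 -(raddfB h) -fu; apply/eqP/hf0.
Qed.

Fact coker_lift_is_linear : linear (coker_lift hf0).
Proof.
move=> a z z'; case: (coker_pi_surj z) (coker_pi_surj z') => y <- [y' <-].
by rewrite -linearP !coker_liftE linearP.
Qed.

HB.instance Definition _ :=
  GRing.isLinear.Build R coker Z _ (coker_lift hf0) coker_lift_is_linear.

End Lift.

Lemma coker_is_cokernel : is_cokernel f coker_pi.
Proof.
split=> [x|Z h hf0]; first by apply/coker_pi_eq0; exists x.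
exists (coker_lift hf0 : {linear _ -> _}) => [y|h' h'pi z]; first exact: coker_liftE.
case: (coker_pi_surj z) => y <-.
by rewrite [RHS]coker_liftE -[LHS]/((h' \o coker_pi) y) h'pi.
Qed.

(** The projection to the cokernel and the zero map agree on the image of [f], so an epimorphism
    forces the projection to vanish. *)
Lemma epimorphismP : epimorphism f <-> (forall y, exists x, f x = y).
Proof.
split=> [epi_f y|surj_f Z g h gfh y].
  apply/coker_pi_eq0; apply: (epi_f _ coker_pi (\0 : {linear _ -> _})) => x.
  by apply/coker_pi_eq0; exists x.
by case: (surj_f y) => x <-; apply: gfh.
Qed.

End Cokernel.

(** * Both Rickart conditions in terms of idempotent endomorphisms *)

Section Rickart.
Variables (R : pzRingType) (N : lmodType R).
Implicit Types f g : {linear N -> N}.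

(** A section [s] with left inverse [r] gives the idempotent [s \o r], whose image is the copy of
    [L] in [N]. Essentiality can be tested by maps on all of [N]: they restrict along [s], and a map
    on the summand extends along its projection. *)
Lemma self_CS_RickartP : self_CS_Rickart N <-> forall f, exists g,
  [/\ forall x, g (g x) = g x, forall x, f x = 0 -> g x = x &
    forall (P : lmodType R) (h : {linear N -> P}),
      (forall x, f x = 0 -> h x = 0 -> x = 0) ->
      forall x, h (g x) = 0 -> g x = 0].
Proof.
split=> CS f.
  have [K [k [[fk0 ker_k] [L [e [s [[mono_e ess_e] [r rs] kse]]]]]]] := CS f.
  have kP x : f x = 0 -> exists y, k y = x.
    case/(@ker_incl_surj _ _ _ f)=> z <-.
    have [i ki _] := ker_k _ (ker_incl f) (ker_inclE (f:=f)).
    by exists (i z); apply: ki.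
  exists (s \o r : {linear N -> N}); split=> [x|x /kP[y <-]|P h hf x] /=.
  - by rewrite [r (s _)]rs.
  - by rewrite kse /= [r (s _)]rs.
  suff /monomorphismP inj : monomorphism (h \o s : {linear L -> P}).
    by move=> hsr; rewrite (inj (r x)) // raddf0.
  apply: ess_e; apply/monomorphismP => y hsey.
  have key : k y = 0 by apply: hf; [apply: fk0|rewrite kse].
  apply: (monomorphismP e).1 mono_e _ _.
  by rewrite -[LHS]rs /= -[s (e y)]/((s \o e) y) -kse key raddf0.
have [g [gg fg ess_g]] := CS f.
(* By idempotence the kernel of [1 - g] is the image of [g]; it serves as [L], with [g] itself
   corestricted to [r] as the splitting. *)
pose i := ker_incl (idfun \- g).
have gi x : g (i x) = i x.
  by apply/esym/eqP; rewrite -subr_eq0; apply/eqP; apply: (ker_inclE x).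
have gP x : (idfun \- g : {linear N -> N}) (g x) = 0 by rewrite /= gg subrr.
pose r : {linear N -> ker (idfun \- g)} := ker_lift gP.
have ir x : i (r x) = g x by [].
have kP x : (idfun \- g : {linear N -> N}) (ker_incl f x) = 0.
  by rewrite /= fg ?subrr //; apply: ker_inclE.
exists (ker f), (ker_incl f); split; first exact: ker_is_kernel.
pose e : {linear ker f -> _} := ker_lift kP.
have ie x : i (e x) = ker_incl f x by [].
exists (ker (idfun \- g)), e, i; split=> //; last first.
  by exists r => x; apply: ker_incl_inj; rewrite -[LHS]/(g (i x)) gi.
split=> [|P h /monomorphismP inj].
  apply/monomorphismP => x ex0; apply: ker_incl_inj.
  by rewrite -ie ex0 !raddf0.
apply/monomorphismP => y hy; apply: ker_incl_inj.
rewrite raddf0 -/i -gi; apply: (ess_g _ (h \o r : {linear _ -> _})) => [x|] /=.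
  case/ker_incl_surj=> k <- hrk; rewrite (inj k) ?raddf0 //= -[RHS]hrk.
  congr (h _); apply: ker_incl_inj.
  rewrite -[LHS]/(ker_incl f k) -[RHS]/(g (ker_incl f k)) fg //.
  exact: ker_inclE.
rewrite -[RHS]hy; congr (h _); apply: ker_incl_inj.
by rewrite -[LHS]/(g (g (i y))) !gi.
Qed.

(** The idempotent is [s \o r] for a right inverse [s] of [r]. A map [h] into [N] is onto modulo the
    image of [f] when its image and that of [f] add up to [N]; superfluity of [t] then makes
    [r \o h] onto. *)
Lemma dual_self_CS_RickartP : dual_self_CS_Rickart N <-> forall f, exists g,
  [/\ forall x, g (g x) = g x, forall x, exists y, f y = x - g x &
    forall (P : lmodType R) (h : {linear P -> N}),
      (forall x, exists p y, x = h p + f y) ->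
      forall x, exists p, g x = g (h p)].
Proof.
split=> dCS f.
  have [C [c [[cf0 coker_c] [P [r [t [[s rs] [epi_t sup_t] ctr]]]]]]] := dCS f.
  have cP x : c x = 0 -> exists y, f y = x.
    move=> cx0; apply/coker_pi_eq0.
    have [|i ic _] := coker_c _ (coker_pi f : {linear N -> coker f}).
      by move=> y; apply/coker_pi_eq0; exists y.
    by rewrite -[LHS]ic /= cx0 raddf0.
  exists (s \o r : {linear N -> N}); split=> [x|x|Q h hf x] /=.
  - by rewrite [r (s _)]rs.
  - by apply: cP; rewrite ctr /= raddfB /= [r (s _)]rs subrr raddf0.
  suff /epimorphismP surj : epimorphism (r \o h : {linear Q -> P}).
    by have [p <-] := surj (r x); exists p.
  apply: sup_t; apply/epimorphismP => z.
  have [/= y <-] := (epimorphismP _).1 epi_t z.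
  have [p [w def_y]] := hf (s y); exists p => /=.
  rewrite -[in RHS](rs y) /= -[RHS]/((t \o r) _) -[LHS]/((t \o r) _) -!ctr def_y.
  by rewrite linearD [X in _ + X]cf0 addr0.
have [g [gg cg sup_g]] := dCS f.
exists (coker f), (coker_pi f : {linear _ -> _}).
split; first exact: coker_is_cokernel.
pose i := ker_incl (idfun \- g).
have gi x : g (i x) = i x.
  by apply/esym/eqP; rewrite -subr_eq0; apply/eqP; apply: (ker_inclE x).
have gP x : (idfun \- g : {linear N -> N}) (g x) = 0 by rewrite /= gg subrr.
pose r : {linear N -> ker (idfun \- g)} := ker_lift gP.
have ir x : i (r x) = g x by [].
exists (ker (idfun \- g)), r, (coker_pi f \o i : {linear _ -> _}); split.
- by exists i => x; apply: ker_incl_inj; apply: gi.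
- split=> [|P h /epimorphismP surj].
    apply/epimorphismP => z; have [x <-] := coker_pi_surj z.
    exists (r x); apply/coker_pi_eq; rewrite ir.
    by have [y fy] := cg x; exists (- y); rewrite linearN fy opprB.
  apply/epimorphismP => y.
  (* The test map [h] into the summand is included in [N] by [i]; surjectivity modulo the image of
     [f] gives the sum condition. *)
  have [p] : exists p, g (i y) = g ((i \o h) p).
    apply: sup_g => x.
    have [/= p /coker_pi_eq[u fu]] := surj (coker_pi f x).
    by exists p, (- u); rewrite linearN fu opprB addrC subrK.
  by rewrite /= !gi => /ker_incl_inj ->; exists p.
move=> x /=; apply/coker_pi_eq; exact: cg.
Qed.

End Rickart.

(** * The Rickart conditions on a regular module, in terms of ring elements *)

Section RegularModule.
Variable A : pzRingType.

Section Orbit.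
Variables (X : lmodType A) (x : X).

Definition orbit_map (a : A^o) : X := (a : A) *: x.

Fact orbit_map_is_linear : linear orbit_map.
Proof. by move=> a b c; rewrite /orbit_map scalerDl -scalerA. Qed.

HB.instance Definition _ :=
  GRing.isLinear.Build A A^o X _ orbit_map orbit_map_is_linear.

End Orbit.

Lemma linear_regularE (X : lmodType A) (f : {linear A^o -> X}) (a : A) :
  f a = a *: f 1.
Proof. by rewrite -linearZ; congr (f _); rewrite [RHS]mulr1. Qed.

(** Every endomorphism of [A^o] is right multiplication by its value at [1]. For [A = (endo M)^c]
    the product [x * f] is the composite [f \o x]; for [A = endo M] it is [x \o f]. *)
Lemma regular_self_CS_RickartP : self_CS_Rickart A^o <->
  forall f : A, exists g : A,
  [/\ g * g = g, forall x, x * f = 0 -> x * g = x &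
    forall (P : lmodType A) (h : {linear A^o -> P}),
      (forall x : A, x * f = 0 -> h x = 0 -> x = 0) ->
      forall x : A, h (x * g) = 0 -> x * g = 0].
Proof.
rewrite self_CS_RickartP; split=> CS f.
  have [g [gg fg ess_g]] := CS (orbit_map (f : A^o)).
  exists (g 1); split=> [|x xf0|P h hf x hx].
  - by rewrite -[LHS](linear_regularE g) gg.
  - by rewrite -[LHS](linear_regularE g); apply: fg.
  rewrite -[LHS](linear_regularE g); apply: (ess_g _ h) => //.
  by rewrite (linear_regularE g).
have [g [gg fg ess_g]] := CS (f 1).
exists (orbit_map (g : A^o)); split=> [x|x|P h hf] /=.
- by rewrite /orbit_map -scalerA; congr (_ *: _).
- by rewrite linear_regularE; apply: fg.
by apply: ess_g => x xf0; apply: hf; rewrite linear_regularE.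
Qed.

(** By linearity the last two conditions need only be tested at [1]. *)
Lemma regular_dual_self_CS_RickartP : dual_self_CS_Rickart A^o <->
  forall f : A, exists g : A,
  [/\ g * g = g, exists y, y * f = 1 - g &
    forall (P : lmodType A) (h : {linear P -> A^o}),
      (forall x : A, exists p (y : A), x = h p + y * f) ->
      exists p, g = (h p : A) * g].
Proof.
rewrite dual_self_CS_RickartP; split=> CS f.
  have [g [gg fg sup_g]] := CS (orbit_map (f : A^o)).
  exists (g 1); split=> [||P h hf].
  - by rewrite -[LHS](linear_regularE g) gg.
  - by have [y fy] := fg 1; exists y.
  have [p gp] := sup_g P h hf 1.
  by exists p; rewrite {1}gp linear_regularE.
have [g [gg [y yf] sup_g]] := CS (f 1).
exists (orbit_map (g : A^o)); split=> [x|x|P h hf x] /=.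
- by rewrite /orbit_map -scalerA; congr (_ *: _).
- exists (x * y); rewrite linear_regularE -scalerA.
  by rewrite [y *: _]yf [LHS]mulrBr mulr1.
have [|p gp] := sup_g P h.
  by move=> z; have [p [w ->]] := hf z; exists p, w; rewrite linear_regularE.
by exists (x *: p); rewrite linearZ /orbit_map -[RHS]scalerA; congr (_ *: _).
Qed.

End RegularModule.

(** * Vanishing tests from faithful Hom functors, and lifting from projectives *)

Section Faithfulness.
Variables (R : pzRingType) (M A B : lmodType R) (phi : {linear A -> B}).

(* The sequence [A -phi-> B -id-> B] is exact if and only if [phi = 0]. *)
Lemma faithfully_projective_eq0 : faithfully_projective M ->
  (forall u : {linear M -> A}, phi \o u =1 \0) -> phi =1 \0.
Proof.
move=> faith phi0 a; pose idB : {linear B -> B} := idfun.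
suff /faith ex : exact (hom_from_map (M := M) phi) (hom_from_map (M := M) idB).
  by apply: (ex (phi a)).2; exists a.
move=> b; have -> : hom_from_map idB b = b by apply: linear_ext.
split=> [->|[u <-]]; last by apply: linear_ext => m; apply: phi0.
by exists 0; apply: raddf0.
Qed.

(* The sequence [A -id-> A -phi-> B] is exact if and only if [phi = 0]. *)
Lemma faithfully_injective_eq0 : faithfully_injective M ->
  (forall u : {linear B -> M}, u \o phi =1 \0) -> phi =1 \0.
Proof.
move=> faith phi0 a; pose idA : {linear A -> A} := idfun.
suff /faith ex : exact (hom_to_map (M := M) phi) (hom_to_map (M := M) idA).
  by apply: (ex a).2; exists a.
move=> b; have -> : hom_to_map idA b = b by apply: linear_ext.
split=> [->|[u <-]]; last by apply: linear_ext => m; apply: phi0.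
by exists 0; apply: raddf0.
Qed.

End Faithfulness.

(** Projectivity is applied not to [g] but to the projection onto [P] of the pullback of [g] and
    [h], realized as [ker d]. This projection is onto, and a splitting of it followed by the
    projection to [X] is the lift. *)
Lemma projective_lift (R : pzRingType) (P X Y : lmodType R)
    (g : {linear X -> Y}) (h : {linear P -> Y}) : projective P ->
  (forall p, exists x, g x = h p) -> exists h' : {linear P -> X}, g \o h' =1 h.
Proof.
move=> proj gh.
pose d : {linear (X * P)%type -> Y} := (g \o fst) \- (h \o snd).
pose q : {linear ker d -> P} := snd \o ker_incl d.
have [|s qs] := proj _ _ q (idfun : {linear P -> P}).
  apply/epimorphismP => p; have [x gx] := gh p.
  have [|k dk] := @ker_incl_surj _ _ _ d (x, p); first by rewrite /= gx subrr.
  by exists k; rewrite -[LHS]/(ker_incl d k).2 dk.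
exists (fst \o ker_incl d \o s : {linear _ -> _}) => p.
have /eqP := ker_inclE (s p); rewrite /= subr_eq0 => /eqP ->.
by congr (h _); apply: qs.
Qed.

(** * Transfer between a module and its endomorphism ring through Hom *)

Section Endomorphisms.
Variables (R : pzRingType) (M : lmodType R).

Section PostComposition.
Variables (P : lmodType R) (h : {linear P -> M}).

(** This is [hom_from_map h] with its target viewed as the regular right module. *)
Definition postcomp (u : hom_from M P) : (endo M)^c^o := hom_comp h u.

Fact postcomp_is_linear : linear postcomp.
Proof. by move=> s u v; apply: linear_ext => x /=; rewrite raddfD. Qed.

HB.instance Definition _ := GRing.isLinear.Build (endo M)^c
  (hom_from M P) (endo M)^c^o _ postcomp postcomp_is_linear.

End PostComposition.

(** Each required identity says that a map out of a kernel into [M] is zero. By faithfulness it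
    suffices to precompose with maps from [M], which turns it into an identity in [endo M]. *)
Lemma self_CS_Rickart_of_endo : faithfully_projective M ->
  self_CS_Rickart (endo M)^c^o -> self_CS_Rickart M.
Proof.
move=> faith /regular_self_CS_RickartP CS; apply/self_CS_RickartP => f.
have [g [gg fg ess_g]] := CS (f : endo M).
exists (g : {linear M -> M}); split=> [x|x|P h hf x hgx].
- by rewrite -[LHS]/((g * g) x) gg.
- case/ker_incl_surj=> k <-; apply/esym/eqP; rewrite -subr_eq0; apply/eqP.
  pose phi : {linear ker f -> M} := (idfun \- g) \o ker_incl f.
  apply: (faithfully_projective_eq0 (phi := phi) faith) => u m.
  rewrite /= [X in _ - X](_ : _ = ker_incl f (u m)) ?subrr //.
  pose v : endo M := ker_incl f \o u : {linear _ -> _}.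
  rewrite -[RHS]/(v m) -[in RHS](fg v) //.
  by apply: linear_ext => m'; apply: (ker_inclE (u m')).
have /ker_incl_surj[k <-] : (h \o g) x = 0 by [].
pose phi : {linear ker (h \o g) -> M} := g \o ker_incl (h \o g).
apply: (faithfully_projective_eq0 (phi := phi) faith) => u m.
pose v : endo M := ker_incl (h \o g) \o u : {linear _ -> _}.
suff e : (v : (endo M)^c) * g = 0 by rewrite -[LHS]/(((v : (endo M)^c) * g) m) e.
(* The test map on the endomorphism ring is [w] to [h \o w]. *)
apply: (ess_g _ (orbit_map (h : hom_from M P))) => [w wf0 wh0|].
  apply: linear_ext => m'; apply: hf.
    by rewrite -[LHS]/(((w : (endo M)^c) * (f : endo M)) m') wf0.
  by rewrite -[LHS]/((orbit_map (h : hom_from M P) w) m') wh0.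
by apply: linear_ext => m'; apply: (ker_inclE (u m')).
Qed.

(** If the images of [h] and [f] add up to [M], projectivity lifts every endomorphism of [M] along
    the sum map from [P * M], so [postcomp h] satisfies the same sum condition in [endo M]. *)
Lemma dual_self_CS_Rickart_of_endo : projective M ->
  dual_self_CS_Rickart (endo M)^c^o -> dual_self_CS_Rickart M.
Proof.
move=> proj /regular_dual_self_CS_RickartP CS; apply/dual_self_CS_RickartP => f.
have [g [gg [a af] sup_g]] := CS (f : endo M).
exists (g : {linear M -> M}); split=> [x|x|P h hf x].
- by rewrite -[LHS]/((g * g) x) gg.
- by exists (a x); rewrite -[LHS]/(((a : (endo M)^c) * (f : endo M)) x) af.
have [|p gp] := sup_g _ (postcomp h).
  move=> y; pose d : {linear (P * M)%type -> M} := (h \o fst) \+ (f \o snd).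
  have [m|l dl] := projective_lift (g := d) (h := y) proj.
    by have [p [z hfm]] := hf (y m); exists (p, z); rewrite /= hfm.
  exists (fst \o l : {linear M -> P}), (snd \o l : {linear M -> M}).
  by apply: linear_ext => m; rewrite -dl.
exists ((p : {linear M -> P}) x).
by rewrite {1}gp.
Qed.

(** If [x * f = 0], then [x] kills the image of [f], hence that of [1 - g]. For essentiality,
    superfluity replaces any [g m] by [g p] with [p] in the kernel of [x * g]. *)
Lemma endo_left_self_CS_Rickart : injective_module (evalmod M) ->
  dual_self_CS_Rickart M -> self_CS_Rickart (endo M)^o.
Proof.
move=> inj /dual_self_CS_RickartP CS; apply/regular_self_CS_RickartP => f.
have [g [gg fg sup_g]] := CS (f : {linear M -> M}).
exists g; split=> [|x xf0|P h hf x hxg].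
- exact: linear_ext.
- apply: linear_ext => m /=; apply/esym/eqP; rewrite -subr_eq0 -(raddfB x).
  have [y <-] := fg m; apply/eqP.
  by rewrite -[LHS]/((x * f) y) xf0.
(* [M = ker (x g) + f M]: extending [u f |-> u m] from [(ker h) f] to [endo M]
   yields [m'] with [m - f m'] killed by [ker h]. *)
have ker_sum m : exists p y, m = ker_incl (x * g : {linear M -> M}) p + f y.
  pose j : {linear ker h -> (endo M)^o} := orbit_map (f : (endo M)^o) \o ker_incl h.
  have mono_j : monomorphism j.
    apply/monomorphismP => u uf0; apply: ker_incl_inj; rewrite raddf0.
    exact: hf uf0 (ker_inclE u).
  have [psi psiE] :=
    inj _ _ _ (orbit_map (m : evalmod M) \o ker_incl h : {linear _ -> _}) mono_j.
  pose m' : M := psi 1.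
  have [u xgu] := ker_incl_surj hxg.
  have [|p pE] := @ker_incl_surj _ _ _ (x * g : {linear M -> M}) (m - f m').
    rewrite (raddfB (x * g : {linear M -> M})) -xgu.
    apply/eqP; rewrite subr_eq0 eq_sym; apply/eqP.
    by rewrite -[RHS](psiE u) /= linear_regularE.
  by exists p, m'; rewrite pE subrK.
apply: linear_ext => m /=.
have [p gmp] := sup_g _ _ ker_sum m.
by rewrite gmp; apply: (ker_inclE p).
Qed.

(** Each required membership in an image says that a map from [M] to a cokernel is zero. By
    faithfulness this is tested by maps [u] from the cokernel to [M], which give endomorphisms [v]
    of [M]. *)
Lemma dual_self_CS_Rickart_of_endo_left : faithfully_injective M ->
  self_CS_Rickart (endo M)^o -> dual_self_CS_Rickart M.
Proof.
move=> faith /regular_self_CS_RickartP CS; apply/dual_self_CS_RickartP => f.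
have [g [gg fg ess_g]] := CS f.
exists (g : {linear M -> M}); split=> [x|x|P h hf x].
- by rewrite -[LHS]/((g * g) x) gg.
- apply/coker_pi_eq0.
  pose phi : {linear M -> coker f} := coker_pi f \o (idfun \- g).
  apply: (faithfully_injective_eq0 (phi := phi) faith) => u m.
  pose v : endo M := u \o coker_pi f : {linear _ -> _}.
  rewrite -[LHS]/(v (m - g m)) (raddfB (v : {linear M -> M})).
  rewrite -[X in _ - X]/((v * g) m) fg ?subrr //.
  apply: linear_ext => m'; rewrite -[RHS](raddf0 u); congr (u _).
  by apply/coker_pi_eq0; exists m'.
suff /coker_pi_eq0[p gp] : coker_pi (g \o h) (g x) = 0 by exists p.
pose phi : {linear M -> coker (g \o h)} := coker_pi (g \o h) \o g.
apply: (faithfully_injective_eq0 (phi := phi) faith) => u m.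
pose v : endo M := u \o coker_pi (g \o h) : {linear _ -> _}.
suff e : v * g = 0 by rewrite -[LHS]/((v * g) m) e.
(* The test map is [w] to [w \o h]; an endomorphism killing the images of both [h] and [f] kills
   their sum [M]. *)
apply: (ess_g _ (orbit_map (h : hom_to M P))) => [w wf0 wh0|].
  apply: linear_ext => m'; have [p [y ->]] := hf m'.
  rewrite linearD -[w (h p)]/((orbit_map (h : hom_to M P) w) p) wh0.
  by rewrite -[w (f y)]/((w * f) y) wf0 addr0.
apply: linear_ext => p; rewrite -[RHS](raddf0 u); congr (u _).
by apply/coker_pi_eq0; exists p.
Qed.

End Endomorphisms.

(** * Transfer between a module and its endomorphism ring through the tensor product *)

Lemma tensor_mapB (S : pzRingType) (X Y : lmodType S^c) (N N' : lmodType S)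
    (f : {linear X -> Y}) (g : {linear N -> N'}) :
  {morph tensor_map f g : t u / t - u}.
Proof. exact: raddfB. Qed.

Section TensorZero.
Variables (S : pzRingType) (X : lmodType S^c) (N : lmodType S).

Lemma tens0l n : tens (0 : X) (n : N) = 0.
Proof. by apply: (addIr (tens (0 : X) n)); rewrite -tensDl !add0r. Qed.

Lemma tens0r x : tens (x : X) (0 : N) = 0.
Proof. by apply: (addIr (tens x (0 : N))); rewrite -tensDr !add0r. Qed.

Lemma tensBr x n m : tens (x : X) (n - m : N) = tens x n - tens x m.
Proof. by apply/eqP; rewrite eq_sym subr_eq -tensDr subrK. Qed.

End TensorZero.

Section TensorMapZero.
Variables (S : pzRingType) (X Y : lmodType S^c) (N : lmodType S).

Lemma tensor_map0 (t : tensor X N) :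
  tensor_map (\0 : {linear X -> Y}) (idfun : {linear N -> N}) t = 0.
Proof.
elim/tensor_ind: t => [|t u IHt IHu|x n]; first exact: raddf0.
  by rewrite tensor_mapB IHt IHu subrr.
by rewrite tensor_mapE tens0l.
Qed.

Lemma tensor_map_id (t : tensor X N) :
  tensor_map (idfun : {linear X -> X}) (idfun : {linear N -> N}) t = t.
Proof.
elim/tensor_ind: t => [|t u IHt IHu|x n]; first exact: raddf0.
  by rewrite tensor_mapB IHt IHu.
by rewrite tensor_mapE.
Qed.

End TensorMapZero.

Section Tensor.
Variables (R : pzRingType) (M : lmodType R^c).

Section Evaluation.
Variables (X : lmodType (endo M)^c) (phi : {linear X -> (endo M)^c^o}).

(** When [phi] is the inclusion of a right ideal [U], the image of this map is [U M]. *)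
Definition tensor_act (t : tensor_eval X) : M :=
  tensor_lift (fun x (m : evalmod M) => (phi x : endo M) m : M) t.

Fact tensor_act_balanced :
  balanced (fun x (m : evalmod M) => (phi x : endo M) m : M).
Proof.
split=> [x y m|x m n|s x m]; first by rewrite linearD.
  exact: (raddfD (phi x : {linear M -> M})).
by rewrite linearZ.
Qed.

Lemma tensor_actE x (m : evalmod M) :
  tensor_act (tens x m) = (phi x : endo M) m.
Proof. exact: tensor_liftE tensor_act_balanced _ _. Qed.

Fact tensor_actB : {morph tensor_act : t u / t - u}.
Proof. exact: tensor_lift_is_zmod_morphism tensor_act_balanced. Qed.

Fact tensor_act0 : tensor_act 0 = 0.
Proof. by rewrite -(subrr 0) tensor_actB subrr. Qed.

Fact tensor_act_is_linear : linear tensor_act.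
Proof.
move=> r t u; have -> : r *: t + u = r *: t - (0 - u) by rewrite sub0r opprK.
rewrite !tensor_actB tensor_act0 sub0r opprK; congr (_ + _) => {u}.
elim/tensor_ind: t => [|t u IHt IHu|x m].
- by rewrite scaler0 tensor_act0 scaler0.
- by rewrite scalerBr !tensor_actB IHt IHu scalerBr.
rewrite -[r *: _]/(tensor_eval_scale r (tens x m)) tensor_eval_scaleE.
by rewrite !tensor_actE; apply: (linearZZ (phi x : {linear M -> M})).
Qed.

HB.instance Definition _ := GRing.isLinear.Build R^c
  (tensor_eval X) M _ tensor_act tensor_act_is_linear.

(* Under [endo M (x) M = M], the map [phi (x) M] is [tensor_act]. *)
Lemma tensor_map_act (t : tensor_eval X) :
  tensor_map phi (idfun : {linear evalmod M -> evalmod M}) t =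
  tens (1 : (endo M)^c^o) (tensor_act t : evalmod M).
Proof.
elim/tensor_ind: t => [|t u IHt IHu|x m].
- by rewrite raddf0 tensor_act0 tens0r.
- by rewrite tensor_mapB IHt IHu tensor_actB tensBr.
by rewrite tensor_mapE tensor_actE -[RHS]tensZ [_ *: _]mulr1.
Qed.

(** Flatness preserves exactness of the zero map followed by the injective [phi], and by
    [tensor_map_act] an element killed by [tensor_act] is killed by [phi] tensored with [M]. *)
Lemma tensor_act_inj : flat (evalmod M) -> injective phi ->
  forall t, tensor_act t = 0 -> t = 0.
Proof.
move=> flatM inj_phi t act_t.
have ex : exact (\0 : {linear X -> X}) phi.
  move=> x; split=> [phix0|[y <-]]; last exact: raddf0.
  by exists 0; apply: inj_phi; rewrite phix0 raddf0.
have phit : tensor_map phi (idfun : {linear evalmod M -> evalmod M}) t = 0.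
  by rewrite tensor_map_act act_t tens0r.
by have [u <-] := (flatM _ _ _ _ _ ex t).1 phit; exact: tensor_map0.
Qed.

End Evaluation.

(** Essentiality in [M] is tested on the projection from [M] to its quotient by [U M], where
    [U = ker h]; as [x * g] lies in [U], its values die there. *)
Lemma endo_right_self_CS_Rickart : flat (evalmod M) ->
  self_CS_Rickart M -> self_CS_Rickart (endo M)^c^o.
Proof.
move=> flatM /self_CS_RickartP CS; apply/regular_self_CS_RickartP => f.
have [g [gg fg ess_g]] := CS (f : {linear M -> M}).
exists (g : endo M); split=> [|x xf0|P h hf x hxg].
- exact: linear_ext.
- by apply: linear_ext => m; apply: fg; rewrite -[LHS]/((x * f) m) xf0.
(* On [U = ker h], left multiplication by [f] is injective, and by flatness it
   remains so on [U (x) M]; hence [U M] meets [ker f] trivially. *)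
pose act : {linear tensor_eval (ker h) -> M} := tensor_act (ker_incl h).
have hf' m : f m = 0 -> coker_pi act m = 0 -> m = 0.
  move=> + /coker_pi_eq0[t tm]; rewrite -tm => ft0.
  pose phi : {linear ker h -> (endo M)^c^o} :=
    orbit_map (f : (endo M)^c^o) \o ker_incl h.
  suff -> : t = 0 by apply: raddf0.
  apply: (tensor_act_inj (phi := phi) flatM) => [u v|].
    move=> fuv; apply: ker_incl_inj; apply/eqP; rewrite -subr_eq0; apply/eqP.
    apply: hf; last by rewrite -raddfB; apply: ker_inclE.
    by apply/eqP; rewrite mulrBl subr_eq0; apply/eqP.
  (* The map induced by [phi] is [act] followed by [f], as seen on pure tensors. *)
  rewrite -ft0 => {tm ft0}; elim/tensor_ind: t => [|t u IHt IHu|u n].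
  - by rewrite !raddf0.
  - by rewrite tensor_actB IHt IHu !raddfB.
  by rewrite tensor_actE [act _]tensor_actE.
apply: linear_ext => m; apply: (ess_g _ (coker_pi act) hf').
have [u xgu] := ker_incl_surj hxg.
apply/coker_pi_eq0; exists (tens u (m : evalmod M)).
by rewrite [LHS]tensor_actE xgu.
Qed.

(** The identity of [X] followed by [phi] is exact if and only if [phi] is zero; after tensoring,
    the same criterion can be checked on pure tensors. *)
Lemma faithfully_flat_eq0 (X Y : lmodType (endo M)^c) (phi : {linear X -> Y}) :
  faithfully_flat_eval M ->
  (forall x (m : evalmod M), tens (phi x) m = 0) -> phi =1 \0.
Proof.
move=> faith phi0 x; pose idX : {linear X -> X} := idfun.
suff /faith ex : exact (tensor_eval_map (M := M) idX) (tensor_eval_map (M := M) phi).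
  by apply: (ex x).2; exists x.
move=> t; split=> _; first by exists t; apply: tensor_map_id.
rewrite -[LHS]/(tensor_map phi (idfun : {linear evalmod M -> evalmod M}) t).
elim/tensor_ind: t => [|t u IHt IHu|y m]; first exact: raddf0.
  by rewrite tensor_mapB IHt IHu subrr.
by rewrite tensor_mapE phi0.
Qed.

(** Projectivity lifts [1 - g] through [f]. Superfluity in [M] only compares values, and faithful
    flatness turns that into membership of [g] in the image of [k]. *)
Lemma endo_right_dual_self_CS_Rickart : projective M ->
  faithfully_flat_eval M ->
  dual_self_CS_Rickart M -> dual_self_CS_Rickart (endo M)^c^o.
Proof.
move=> proj faith /dual_self_CS_RickartP CS.
apply/regular_dual_self_CS_RickartP => f.
have [g [gg fg sup_g]] := CS (f : {linear M -> M}).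
exists (g : endo M); split=> [||P h hf].
- exact: linear_ext.
- have [l fl] := projective_lift (h := idfun \- g) proj fg.
  by exists (l : endo M); apply: linear_ext => m; apply: fl.
pose act : {linear tensor_eval P -> M} := tensor_act h.
(* Evaluating a decomposition of [1] at [m] decomposes every [m] in [M]. *)
have [p [y one_hp]] := hf 1.
have act_sup m : exists t z, m = act t + f z.
  exists (tens p (m : evalmod M)), ((y : endo M) m).
  rewrite [X in X + _]tensor_actE.
  exact: (congr1 (fun w : endo M => w m) one_hp).
pose k : {linear P -> (endo M)^c^o} := orbit_map (g : (endo M)^c^o) \o h.
suff /coker_pi_eq0[q qE] : coker_pi k (g : (endo M)^c^o) = 0.
  by exists q; rewrite -[LHS]qE.
(* [G] sends [x] to the class of [g \o x]; its value at [1] is the class of [g], so it suffices that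
   [G] vanish. *)
pose G : {linear (endo M)^c^o -> coker k} :=
  coker_pi k \o orbit_map (g : (endo M)^c^o).
have G1 : G 1 = coker_pi k (g : (endo M)^c^o).
  by congr (coker_pi k _); apply: linear_ext.
rewrite -G1; apply: (faithfully_flat_eq0 faith) => x m.
(* [pi(g x) (x) m = pi(1) (x) g (x m)], and [g M <= g (h P) M]. *)
have -> : G x = ((g : endo M) * (x : endo M) : (endo M)^c) *: coker_pi k 1.
  by rewrite -linearZ; congr (coker_pi k _); apply: linear_ext.
rewrite tensZ.
have [t act_t] := sup_g _ act act_sup ((x : endo M) m).
rewrite -[_ *: m]/(g ((x : endo M) m)) act_t => {act_t}.
elim/tensor_ind: t => [|t u IHt IHu|q n].
- by rewrite !raddf0 tens0r.
- by rewrite !raddfB tensBr IHt IHu subrr.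
(* On a pure tensor, [k q] moves across to the left factor, where it becomes the class of [k q],
   which is zero. *)
rewrite [act _]tensor_actE -[g _]/((k q : endo M) *: n) -tensZ -linearZ.
rewrite [X in tens X _](_ : _ = 0) ?tens0l //.
by apply/coker_pi_eq0; exists q; apply: linear_ext.
Qed.

End Tensor.

Theorem corollary5p4 (R : pzRingType) (M : lmodType R^c) :
  (flat (evalmod M) ->
     (self_CS_Rickart M -> self_CS_Rickart ((endo M)^c^o)) /\
     (faithfully_projective M -> self_CS_Rickart ((endo M)^c^o) ->
        self_CS_Rickart M)) /\
  (projective M ->
     (dual_self_CS_Rickart ((endo M)^c^o) -> dual_self_CS_Rickart M) /\
     (faithfully_flat_eval M -> dual_self_CS_Rickart M ->
        dual_self_CS_Rickart ((endo M)^c^o))) /\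
  (injective_module (evalmod M) ->
     (dual_self_CS_Rickart M -> self_CS_Rickart ((endo M)^o)) /\
     (faithfully_injective M -> self_CS_Rickart ((endo M)^o) ->
        dual_self_CS_Rickart M)).
Proof.
split=> [flatM|]; [split|split=> [projM|injM]; split].
- exact: endo_right_self_CS_Rickart.
- exact: self_CS_Rickart_of_endo.
- exact: dual_self_CS_Rickart_of_endo.
- exact: endo_right_dual_self_CS_Rickart.
- exact: endo_left_self_CS_Rickart.
- exact: dual_self_CS_Rickart_of_endo_left.
Qed.
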